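(* If $G\in\mathcal{G}_{n,n+k}$ with $n\ge2$ and $k\ge0$ has a bridge, then there exists a graph $G'\in\mathcal{G}_{n,n+k}$ such that $d_i(G')<d_i(G)$ for all $i\in\{1,\dots,k+1\}$. Hence, for every $p\in(0,1)$, any $p$-optimal graph in $\mathcal{G}_{n,n+k}$ is bridgeless.
   Context: Graphs are finite connected multigraphs (multiple edges and loops allowed). $\mathcal{G}_{n,m}$ is the set of connected graphs with $n$ vertices and $m$ edges. A bridge is an edge whose deletion disconnects the graph. $d_i(G)$ is the number of sets of $i$ edges of $G$ whose deletion disconnects $G$. For $p\in(0,1)$, $R(G,p)$ is the probability that $G$ remains connected (on all its vertices) when each edge is independently retained with probability $p$ and deleted otherwise; a graph in $\mathcal{G}_{n,m}$ is $p$-optimal if it maximizes $R(\cdot,p)$ over $\mathcal{G}_{n,m}$. *)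

(* Defs.v *)
From mathcomp Require Import all_boot all_order all_algebra.

Set Implicit Arguments.
Unset Strict Implicit.
Unset Printing Implicit Defensive.

Import Order.TTheory GRing.Theory Num.Theory.
Local Open Scope ring_scope.

(* A finite multigraph. Edges form their own type, so parallel edges are
   allowed; a loop is an edge with [src e = tgt e]. The graphs are undirected:
   [src] and [tgt] list the two ends of an edge in an arbitrary order, and
   every notion below is insensitive to that order. *)
Record mgraph := MGraph {
  vertex : finType;
  edge : finType;
  src : edge -> vertex;
  tgt : edge -> vertex }.

Section Multigraph.
Variable G : mgraph.

Definition adj (A : {set edge G}) : rel (vertex G) :=
  [rel x y | [exists e in A, ((src e == x) && (tgt e == y))
                          || ((src e == y) && (tgt e == x))]].

(* The spanning subgraph with all vertices of G and edge set A is connected.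
   (The graph without vertices passes this test; it has no bearing on
   the classes with at least one vertex.) *)
Definition connected_on (A : {set edge G}) : bool :=
  [forall x, forall y, connect (adj A) x y].

Definition connected_graph : bool := connected_on setT.

Definition disconnects (D : {set edge G}) : bool := ~~ connected_on (~: D).

Definition bridge (e : edge G) : bool := disconnects [set e].

Definition has_bridge : bool := [exists e, bridge e].

Definition bridgeless : bool := [forall e, ~~ bridge e].

Definition num_disconnecting (i : nat) : nat :=
  #|[set D : {set edge G} | (#|D| == i) && disconnects D]|.

(* An outcome is the set A of retained edges; the outcomes carry the product
   of the Bernoulli laws, one for each edge, with success probability p. *)
Definition outcome_prob (R : realFieldType) (p : R) (A : {set edge G}) : R :=
  \prod_(e : edge G) (if e \in A then p else 1 - p).

Definition reliability (R : realFieldType) (p : R) : R :=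
  \sum_(A : {set edge G} | connected_on A) outcome_prob p A.

End Multigraph.

(* Membership in the class of connected graphs with n vertices and m edges. *)
Definition in_class (n m : nat) (G : mgraph) : Prop :=
  [/\ connected_graph G, #|vertex G| = n & #|edge G| = m].

Definition optimal (n m : nat) (R : realFieldType) (p : R) (G : mgraph) : Prop :=
  in_class n m G /\
  forall H : mgraph, in_class n m H -> reliability H p <= reliability G p.

(* Main.v *)
Require Import Defs.
From mathcomp Require Import all_boot all_order all_algebra.

(** Let [e] be a bridge of [G], and let [T] be the edge set of a spanning tree
    of [G] ([spanning_tree]). Since [G] has at least as many edges as vertices,
    there is an edge [f] outside [T]. The better graph [G'] is obtained by
    contracting [e] and then subdividing [f]: this loses and regains one vertex
    and one edge. It is realised on the vertices and edges of [G] itself, with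
    the head of [e] in the role of the new vertex and with [e] and [f] as the
    two halves of the subdivided edge ([contract_subdivide]).

    Every edge set that connects [G] contains [e], and it also connects [G'].
    Moreover, if [A] connects [G] and avoids [f], then exchanging [e] for [f]
    gives another edge set that connects [G'], since one half of [f] suffices
    to attach the new vertex; this set misses the bridge [e], so it does not
    connect [G]. Both facts are instances of [connected_contract_subdivide].

    Hence the disconnecting sets of [G'] are among those of [G]. The inclusion
    is strict in every size [i] with [1 <= i <= k + 1]: for any [i - 1] edges
    outside [T], none of them [f], adding [e] gives a set of [i] edges that
    disconnects [G] but not [G']. Such edges exist, since there are at least
    [k] edges outside [T] other than [f]. For [0 < p < 1] each outcome has a
    positive probability, so the strict inclusion of the families of connected
    edge sets also makes [G'] strictly more reliable than [G]. *)

Set Implicit Arguments.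
Unset Strict Implicit.
Unset Printing Implicit Defensive.

Import Order.TTheory GRing.Theory Num.Theory.
Local Open Scope ring_scope.

Lemma adjP (G : mgraph) (A : {set edge G}) (x y : vertex G) :
  reflect (exists2 e, e \in A &
             src e = x /\ tgt e = y \/ src e = y /\ tgt e = x)
          (adj A x y).
Proof.
apply: (iffP existsP) => [[e /andP[eA /orP[] /andP[/eqP sx /eqP ty]]]|].
- by exists e => //; left.
- by exists e => //; right.
by case=> e eA [] [<- <-]; exists e; rewrite eA !eqxx ?orbT.
Qed.

Lemma adj_sym (G : mgraph) (A : {set edge G}) : symmetric (adj A).
Proof.
by move=> x y; apply/adjP/adjP => -[e eA H]; exists e => //; case: H; auto.
Qed.

Lemma connect_adj_sym (G : mgraph) (A : {set edge G}) :
  connect_sym (adj A).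
Proof. by apply: sym_connect_sym; apply: adj_sym. Qed.

Lemma connect_edge (G : mgraph) (A : {set edge G}) (e : edge G) :
  e \in A -> connect (adj A) (src e) (tgt e).
Proof. by move=> eA; apply: connect1; apply/adjP; exists e => //; left. Qed.

Lemma connect_adjS (G : mgraph) (A B : {set edge G}) (x y : vertex G) :
  A \subset B -> connect (adj A) x y -> connect (adj B) x y.
Proof.
move=> /subsetP sAB; apply: connect_sub => a b /adjP[e eA H].
by apply: connect1; apply/adjP; exists e; first exact: sAB.
Qed.

Lemma connected_onP (G : mgraph) (A : {set edge G}) :
  reflect (forall x y, connect (adj A) x y) (connected_on A).
Proof.
by apply: (iffP forallP) => H x; [apply/forallP | apply/forallP => y].
Qed.

Lemma connected_onS (G : mgraph) (A B : {set edge G}) :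
  A \subset B -> connected_on A -> connected_on B.
Proof.
move=> sAB /connected_onP H; apply/connected_onP => x y.
exact: connect_adjS sAB (H x y).
Qed.

Lemma bridge_in_connected (G : mgraph) (e : edge G) (A : {set edge G}) :
  bridge e -> connected_on A -> e \in A.
Proof.
move=> be cA; apply: contraNT be => eA; apply: connected_onS cA.
by apply/subsetP => g gA; rewrite !inE; apply: contraNneq eA => <-.
Qed.

(** Otherwise [S] would be closed under adjacency, and no walk from [x] could
    reach [y]. *)
Lemma connected_boundary (G : mgraph) (S : {set vertex G}) (x y : vertex G) :
  connected_graph G -> x \in S -> y \notin S ->
  exists a b, [/\ a \in S, b \notin S & adj [set: edge G] a b].
Proof.
move=> /connected_onP cG xS yS.
case: (boolP [exists a, exists b,
                [&& a \in S, b \notin S & adj [set: edge G] a b]]).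
  by move=> /existsP[a /existsP[b /and3P[? ? ?]]]; exists a, b.
move=> /existsPn noedge; case/negP: yS.
have clS : closed (adj [set: edge G]) (mem S).
  apply: intro_closed; first exact: connect_adj_sym.
  move=> a b ab aS; apply: contraT => bS.
  by have /existsPn/(_ b)/negP[] := noedge a; apply/and3P.
by rewrite -(closed_connect clS (cG x y)).
Qed.

(** A tree with [j] edges, grown one vertex at a time. *)
Lemma partial_spanning_tree (G : mgraph) (x : vertex G) (j : nat) :
  connected_graph G -> (j < #|vertex G|)%N ->
  exists (S : {set vertex G}) (T : {set edge G}),
    [/\ #|S| = j.+1, (#|T| <= j)%N, x \in S &
        {in S, forall y, connect (adj T) x y}].
Proof.
move=> cG; elim: j => [_|j IHj lt_j].
  exists [set x], set0; rewrite cards1 cards0 set11; split=> // y.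
  by rewrite inE => /eqP->.
have [S [T [cardS cardT xS cS]]] := IHj (ltnW lt_j).
have [y _ yS] : exists2 y, y \in [set: vertex G] & y \notin S.
  by apply/subsetPn/negP => /subset_leq_card; rewrite cardsT cardS leqNgt lt_j.
have [a [b [aS bS /adjP[e _ e_ab]]]] := connected_boundary cG xS yS.
exists (b |: S), (e |: T); split.
- by rewrite cardsU1 bS cardS.
- by rewrite cardsU1 -add1n leq_add // leq_b1.
- by rewrite inE xS orbT.
have cS' z : z \in S -> connect (adj (e |: T)) x z.
  by move=> zS; apply: connect_adjS (cS z zS); apply: subsetUr.
move=> z; rewrite !inE => /orP[/eqP-> | /cS' //].
apply: connect_trans (cS' a aS) (connect1 _).
by apply/adjP; exists e; rewrite ?setU11.
Qed.

Lemma spanning_tree (G : mgraph) :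
  connected_graph G -> (0 < #|vertex G|)%N ->
  exists2 T : {set edge G}, connected_on T & (#|T| < #|vertex G|)%N.
Proof.
move=> cG n_gt0; have /card_gt0P[x _] := n_gt0.
have lt_n : (#|vertex G|.-1 < #|vertex G|)%N by rewrite prednK.
have [S [T [cardS cardT _ cS]]] := partial_spanning_tree x cG lt_n.
have allS y : y \in S.
  suff -> : S = setT by rewrite in_setT.
  by apply/eqP; rewrite eqEcard subsetT cardsT cardS (prednK n_gt0) leqnn.
exists T; last by rewrite -[X in (_ < X)%N](prednK n_gt0) ltnS.
apply/connected_onP => y z; apply: connect_trans (cS z (allS z)).
by rewrite connect_adj_sym cS.
Qed.

(** The contraction of [e], as a map on the vertices: the head of [e] is merged
    into its tail. *)
Definition merge_ends (G : mgraph) (e : edge G) (x : vertex G) : vertex G :=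
  if x == tgt e then src e else x.

(** The graph obtained from [G] by contracting [e] and then subdividing [f], for
    distinct edges [e] and [f]. The head of [e], which the contraction sets
    free, is the subdividing vertex. The half of [f] at its tail keeps the name
    [f], and the half at its head takes the name [e], so that vertices and edges
    are those of [G]. *)
Definition contract_subdivide (G : mgraph) (e f : edge G) : mgraph :=
  @MGraph (vertex G) (edge G)
    (fun g => if g == e then tgt e else merge_ends e (src g))
    (fun g => if g == f then tgt e
              else merge_ends e (tgt (if g == e then f else g))).

(** To connect the new graph it is enough to keep one half of [f], and both
    halves if the walks of [G] use [f]. The set [B] is used as an edge set of
    the new graph. *)
Lemma connected_contract_subdivide (G : mgraph) (e f : edge G)
    (A B : {set edge G}) :
  e != f -> connected_on A -> A :\ e :\ f \subset B ->
  (e \in B) || (f \in B) -> (f \in A -> (e \in B) && (f \in B)) ->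
  connected_on (B : {set edge (contract_subdivide e f)}).
Proof.
move=> ef /connected_onP cA /subsetP sAB ef_B fA_B.
pose G' := contract_subdivide e f; pose B' : {set edge G'} := B.
pose r := merge_ends e.
have fe : (f == e) = false by rewrite eq_sym (negbTE ef).
have half_e : e \in B -> connect (adj B') (tgt e) (r (tgt f)).
  by move/(@connect_edge G' B'); rewrite /= eqxx (negbTE ef).
have half_f : f \in B -> connect (adj B') (r (src f)) (tgt e).
  by move/(@connect_edge G' B'); rewrite /= eqxx fe.
have r_edge g : g \in A -> connect (adj B') (r (src g)) (r (tgt g)).
  move=> gA; have [-> | ge] := eqVneq g e.
    by rewrite /r /merge_ends eqxx; case: ifP.
  have [gf | gf] := eqVneq g f.
    rewrite gf in gA *; have /andP[eB fB] := fA_B gA.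
    exact: connect_trans (half_f fB) (half_e eB).
  have gB : g \in B by apply: sAB; rewrite !inE ge gf.
  by have := @connect_edge G' B' g gB; rewrite /= (negbTE ge) (negbTE gf).
have r_conn x y : connect (adj B') (r x) (r y).
  have /connectP[p] := cA x y; elim: p x => [|z p IHp] x /= => [_ -> // |].
  case/andP=> /adjP[g gA g_xz] pz y_last.
  apply: connect_trans (IHp z pz y_last).
  case: g_xz => -[<- <-]; first exact: r_edge.
  by rewrite connect_adj_sym; apply: r_edge.
have conn_r x : connect (adj B') x (r x).
  have [-> | x_te] := eqVneq x (tgt e); last by rewrite /r /merge_ends (negbTE x_te).
  case/orP: ef_B => [eB | fB]; first exact: connect_trans (half_e eB) _.
  by apply: connect_trans (r_conn (src f) _); rewrite connect_adj_sym half_f.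
apply/connected_onP => x y; apply: connect_trans (conn_r x) _.
by apply: connect_trans (r_conn x y) _; rewrite connect_adj_sym.
Qed.

Lemma connected_contract_subdivide_bridge (G : mgraph) (e f : edge G)
    (A : {set edge G}) :
  e != f -> bridge e -> connected_on A ->
  connected_on (A : {set edge (contract_subdivide e f)}).
Proof.
move=> ef be cA; have eA := bridge_in_connected be cA.
apply: connected_contract_subdivide cA _ _ _ => //; last by rewrite eA.
- by apply: subset_trans (subsetDl _ _) (subsetDl _ _).
- by rewrite eA.
Qed.

(** The improvement of a graph with a bridge, in terms of the family of the
    connected edge sets: it keeps those of [G], and in each of the sizes
    concerned it gains one. The gained set is given by its complement [D]. *)
Lemma bridge_improvement (n k : nat) (G : mgraph) :
  (0 < n)%N -> in_class n (n + k) G -> has_bridge G ->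
  exists e f : edge G, let G' := contract_subdivide e f in
  [/\ connected_graph G',
      forall A : {set edge G},
        connected_on A -> connected_on (A : {set edge G'}) &
      forall i, (1 <= i <= k.+1)%N -> exists D : {set edge G},
        [/\ #|D| = i, disconnects D & connected_on (~: D : {set edge G'})]].
Proof.
move=> n_gt0 [cG cardV cardE] /existsP[e be].
have [T cT] := spanning_tree cG (etrans (congr1 _ cardV) n_gt0).
rewrite cardV => ltTn.
have cardTC : (k < #|~: T|)%N.
  by rewrite -(ltn_add2l #|T|) cardsC cardE ltn_add2r.
have eT := bridge_in_connected be cT.
have /card_gt0P[f] : (0 < #|~: T|)%N by apply: leq_ltn_trans cardTC.
move=> fTC; have fT : f \notin T by rewrite inE in fTC.
have ef : e != f by apply: contraNneq fT => <-.
have keep A := @connected_contract_subdivide_bridge G e f A ef be.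
exists e, f; split=> //; first exact: keep cG.
case=> // i; rewrite ltnS /= ltnS => le_ik.
have /card_gt0P[C] :
    (0 < #|[set C : {set edge G} | C \subset ~: T :\ f & #|C| == i]|)%N.
  rewrite cards_draws bin_gt0 (leq_trans le_ik) // -ltnS.
  by move: cardTC; rewrite (cardsD1 f) fTC.
rewrite inE => /andP[/subsetP sC /eqP cardC].
have eC : e \notin C by apply/negP => /sC; rewrite !inE eT andbF.
have fC : f \notin C by apply/negP => /sC; rewrite !inE eqxx.
exists (e |: C); split; first by rewrite cardsU1 eC cardC.
  by apply/negP => /(bridge_in_connected be); rewrite !inE eqxx.
(* Deleting [e] and [C] from the new graph leaves what deleting [f] and [C]
   leaves in [G], up to the exchange of [e] and [f]. *)
have cA : connected_on (~: (f |: C)).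
  apply: connected_onS cT; apply/subsetP => g gT; rewrite !inE negb_or.
  apply/andP; split; first by apply: contraNneq fT => <-.
  by apply/negP => /sC; rewrite !inE gT andbF.
apply: connected_contract_subdivide cA _ _ _ => //.
- apply/subsetP => g; rewrite !inE.
  by case/and3P=> /negbTE-> /negbTE->.
- by rewrite !inE (negbTE fC) eq_sym (negbTE ef) orbT.
by rewrite !inE eqxx.
Qed.

Lemma outcome_prob_gt0 (G : mgraph) (R : realFieldType) (p : R)
    (A : {set edge G}) :
  0 < p < 1 -> 0 < outcome_prob p A.
Proof.
by case/andP=> p0 p1; apply: prodr_gt0 => g _; case: ifP; rewrite ?subr_gt0.
Qed.

Theorem proposition2p2 (n k : nat) (hn : (2 <= n)%N) :
  (forall G : mgraph, in_class n (n + k)%N G -> has_bridge G ->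
     exists G' : mgraph, in_class n (n + k)%N G' /\
       forall i : nat, (1 <= i <= k.+1)%N ->
         (num_disconnecting G' i < num_disconnecting G i)%N)
  /\
  (forall (R : realFieldType) (p : R), 0 < p < 1 ->
     forall G : mgraph, optimal n (n + k)%N p G -> bridgeless G).
Proof.
have n_gt0 : (0 < n)%N by apply: ltnW.
split=> [G clG bG | R p p01 G [clG optG]].
  have [e [f [cG' keep gain]]] := bridge_improvement n_gt0 clG bG.
  case: clG => _ cardV cardE.
  exists (contract_subdivide e f); split=> // i /gain[D [cardD dD cD]].
  apply: proper_card; apply/properP; split.
    apply/subsetP => D'; rewrite !inE => /andP[-> /=].
    exact: contra (keep _).
  by exists D; rewrite !inE cardD eqxx //= negbK.
apply: contraT => /forallPn/= [e0]; rewrite negbK => be0.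
have bG : has_bridge G by apply/existsP; exists e0.
have [e [f [cG' keep gain]]] := bridge_improvement n_gt0 clG bG.
have [|D [_ dD cD]] := gain 1; first by [].
case: clG => _ cardV cardE.
have /optG : in_class n (n + k) (contract_subdivide e f) by [].
rewrite leNgt => /negP[]; rewrite /reliability.
(* Split the sum for the new graph into the sets that connect [G] and the
   others; the complement of [D] is among the others. *)
rewrite [ltRHS](bigID (fun A : {set edge G} => connected_on A)) /=.
rewrite [X in _ < X + _](eq_bigl (fun A : {set edge G} => connected_on A)).
  rewrite ltrDl (bigD1 (~: D)) /=; last by rewrite cD.
  apply: ltr_pwDl; first exact: outcome_prob_gt0.
  by apply: sumr_ge0 => A _; apply/ltW/outcome_prob_gt0.
by move=> A /=; apply: andb_idl; apply: keep.
Qed.
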